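(* Let $G_1$ be a PMH-graph admitting a vertex $u$ of degree $3$, let $G_2$ be a graph admitting a 3-malleable vertex $v$, and let $G_1(u)*G_2(v)$ be a graph obtained by a star product on $u$ and $v$. If at least one of $G_1$ and $G_2$ is bipartite, then $G_1(u)*G_2(v)$ is PMH.
   Context: Graphs are finite and connected, may have multiple (parallel) edges, and have no loops; the degree of a vertex is the number of edges incident to it. A perfect matching is the edge set of a $1$-regular spanning subgraph, and a Hamiltonian cycle is a connected $2$-regular spanning subgraph. A Hamiltonian cycle $H$ extends a perfect matching $M$ if $M\subseteq E(H)$. A graph admitting a perfect matching is PMH if each of its perfect matchings can be extended to a Hamiltonian cycle. For a vertex $v$, $\partial v$ denotes the set of edges incident to $v$. If $G$ admits a perfect matching and $v$ is a vertex of degree $t\ge 2$, then $v$ is $t$-malleable if for every perfect matching $M$ of $G$ there exist Hamiltonian cycles $H_1,\dots,H_{t-1}$ of $G$, all extending $M$, such that $\partial v - M\subset \bigcup_{i=1}^{t-1}E(H_i)$. (In particular, a graph with a malleable vertex admits a perfect matching.) Star product: let $u\in V(G_1)$, $v\in V(G_2)$ be vertices of degree 3, with incident edges $uu_1,uu_2,uu_3$ and $vv_1,vv_2,vv_3$ respectively. A star product on $u$ and $v$, denoted $G_1(u)*G_2(v)$, is the graph $(G_1-u)\cup(G_2-v)\cup\{u_1v_1,u_2v_2,u_3v_3\}$ (for any choice of the ordering of the neighbours). It is assumed that neither $G_1$ nor $G_2$ is the cubic graph on two vertices (three parallel edges). *)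

(* Defs.v *)
From mathcomp Require Import all_boot.

Set Implicit Arguments.
Unset Strict Implicit.
Unset Printing Implicit Defensive.

(* Finite loopless multigraphs: parallel edges are distinct elements of [edge]
   with the same set of ends. Connectedness is the separate predicate
   [connected_graph]. *)
Record mgraph := MGraph {
  vert : finType;
  edge : finType;
  ends : edge -> {set vert};
  card_ends : forall e : edge, #|ends e| = 2
}.

(* A spanning subgraph is given by its edge set F : {set edge G}. *)
Section Graph.
Variable G : mgraph.
Implicit Types (F H M : {set edge G}) (x y v : vert G).

Definition incident x : {set edge G} := [set e | x \in ends e].

Definition degree_in F x : nat := #|incident x :&: F|.

Definition degree x : nat := #|incident x|.

Definition adjacent_in F : rel (vert G) :=
  [rel x y | [exists e in F, ends e == [set x; y]]].

Definition spanning_connected F : Prop :=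
  forall x y, connect (adjacent_in F) x y.

Definition regular_in (k : nat) F : Prop := forall x, degree_in F x = k.

Definition perfect_matching M : Prop := regular_in 1 M.

Definition hamiltonian_cycle H : Prop :=
  regular_in 2 H /\ spanning_connected H.

Definition extends H M : Prop := M \subset H.

Definition connected_graph : Prop := spanning_connected [set: edge G].

Definition bipartite : Prop :=
  exists A : {set vert G}, forall e : edge G, #|ends e :&: A| = 1.

Definition PMH : Prop :=
  (exists M, perfect_matching M) /\
  (forall M, perfect_matching M ->
     exists H, hamiltonian_cycle H /\ extends H M).

Definition malleable (t : nat) v : Prop :=
  [/\ 2 <= t, degree v = t, exists M, perfect_matching M &
      forall M, perfect_matching M ->
        exists H : 'I_t.-1 -> {set edge G},
          (forall i, hamiltonian_cycle (H i) /\ extends (H i) M) /\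
          incident v :\: M \subset \bigcup_i H i].

Definition cubic_on_two_vertices : Prop :=
  #|vert G| = 2 /\ (forall x, degree x = 3).

(* An ordering of the edges at a vertex of degree 3. Edges are ordered rather
   than neighbours, since neighbours may coincide when edges are parallel. *)
Record edge_ordering x := EdgeOrdering {
  nth_edge :> 'I_3 -> edge G;
  nth_edge_inj : injective nth_edge;
  nth_edge_incident : nth_edge @: [set: 'I_3] = incident x
}.

End Graph.

Section StarProduct.
Variables (G1 G2 : mgraph) (u : vert G1) (v : vert G2).
Variables (a : edge_ordering u) (b : edge_ordering v).

Definition star_vert : finType :=
  ({x : vert G1 | x != u} + {y : vert G2 | y != v})%type.

(* Edges of G1 - u, edges of G2 - v, and the three new edges. *)
Definition star_edge : finType :=
  ({e : edge G1 | e \notin incident u} +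
   {e : edge G2 | e \notin incident v} + 'I_3)%type.

(* The i-th new edge joins u_i, the end of [a i] other than u, to v_i, the end
   of [b i] other than v. *)
Definition star_ends (e : star_edge) : {set star_vert} :=
  match e with
  | inl (inl e1) => inl @: [set x | val x \in ends (val e1)]
  | inl (inr e2) => inr @: [set y | val y \in ends (val e2)]
  | inr i => (inl @: [set x | val x \in ends (a i)]) :|:
             (inr @: [set y | val y \in ends (b i)])
  end.

Lemma card_sub_ends (G : mgraph) (w : vert G) (e : edge G) :
  #|[set x : {x : vert G | x != w} | val x \in ends e]| = #|ends e :\ w|.
Proof.
rewrite -(card_imset _ val_inj); apply: eq_card => x.
rewrite !inE; apply/imsetP/andP => [[y] | [xw xe]].
  by rewrite inE => ye ->; split=> //; exact: (valP y).
by exists (Sub x xw); rewrite ?inE SubK.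
Qed.

Lemma card_star_ends (e : star_edge) : #|star_ends e| = 2.
Proof.
have inl_inj : injective (@inl {x : vert G1 | x != u} {y : vert G2 | y != v}).
  by move=> x y [].
have inr_inj : injective (@inr {x : vert G1 | x != u} {y : vert G2 | y != v}).
  by move=> x y [].
have off (G : mgraph) (w : vert G) (f : edge G) :
    f \notin incident w -> #|ends f :\ w| = 2.
  by rewrite inE => wf; have := cardsD1 w (ends f); rewrite card_ends (negPf wf).
have on (G : mgraph) (w : vert G) (o : edge_ordering w) i :
    #|ends (o i) :\ w| = 1.
  have : o i \in incident w by rewrite -(nth_edge_incident o) imset_f.
  rewrite inE => wf; have := cardsD1 w (ends (o i)).
  by rewrite card_ends wf add1n => -[<-].
case: e => [[e | e] | i] /=.
- by rewrite card_imset // card_sub_ends off // (valP e).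
- by rewrite card_imset // card_sub_ends off // (valP e).
rewrite cardsU !card_imset // !card_sub_ends !on.
rewrite (_ : _ :&: _ = set0) ?cards0 //.
apply/setP => z; rewrite !inE; apply/negP => /andP[/imsetP[x _ ->]].
by case/imsetP.
Qed.

Definition star_product : mgraph := MGraph card_star_ends.

End StarProduct.

(* Main.v *)
(** A perfect matching [M] of the star product induces edge sets of [G1] and
    [G2] that have degree 1 away from [u] and [v] and the same degree at [u] and
    [v].  In the bipartite factor the two colour classes have equal size, and
    double counting shows that this common degree is 1.  So [M] restricts to
    perfect matchings [M1] and [M2], which use the same new edge [k].  A
    Hamiltonian cycle of [G1] extending [M1] uses one more edge [a j] at [u], and
    malleability gives a Hamiltonian cycle of [G2] extending [M2] and using
    [b j].  The two cycles glue, because a Hamiltonian cycle stays connected when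
    a vertex is deleted (by parity). *)
Require Import Defs.
From mathcomp Require Import all_boot.

Set Implicit Arguments.
Unset Strict Implicit.
Unset Printing Implicit Defensive.

(** * Degree counting and deletion of a vertex from a Hamiltonian cycle *)

Section Graph.
Variable G : mgraph.
Implicit Types (F H M : {set edge G}) (x y w : vert G) (A : {set vert G}).

Lemma ends_eq2 (e : edge G) x y :
  x != y -> x \in ends e -> y \in ends e -> ends e = [set x; y].
Proof.
move=> xy xe ye; apply/esym/eqP; rewrite eqEcard card_ends cards2 xy.
by rewrite subUset !sub1set xe ye.
Qed.

Lemma exists_other_end (e : edge G) w :
  w \in ends e -> exists2 x, x != w & ends e = [set w; x].
Proof.
move=> we; have /eqP/cards1P[x xE] : #|ends e :\ w| = 1.
  by have := cardsD1 w (ends e); rewrite card_ends we add1n => -[<-].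
have : x \in ends e :\ w by rewrite xE set11.
rewrite !inE => /andP[xw xe]; exists x => //.
by apply: ends_eq2; rewrite // eq_sym.
Qed.

Lemma adjacent_in_sym F : symmetric (adjacent_in F).
Proof. by move=> x y /=; apply: eq_existsb => e; rewrite setUC. Qed.

Lemma sum_degree_in F A :
  \sum_(x in A) degree_in F x = \sum_(e in F) #|ends e :&: A|.
Proof.
under eq_bigr => x _ do rewrite /degree_in -sum1_card big_mkcond.
rewrite exchange_big [RHS]big_mkcond; apply: eq_bigr => e _.
rewrite -sum1_card; case: ifP => eF.
  rewrite [RHS]big_mkcond [LHS]big_mkcond /=; apply: eq_bigr => x _.
  by rewrite !inE eF andbT andbC; case: (x \in A).
by rewrite big1 // => x _; rewrite inE eF andbF.
Qed.

Lemma degree_in_ordering w (o : edge_ordering w) F :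
  degree_in F w = #|[set i | o i \in F]|.
Proof.
rewrite /degree_in -(card_imset _ (@nth_edge_inj _ _ o)); apply: eq_card => e.
rewrite inE -(nth_edge_incident o); apply/andP/imsetP.
  by case=> /imsetP[i _ ->] iF; exists i; rewrite ?inE.
by case=> i; rewrite inE => iF ->; rewrite imset_f.
Qed.

(** Used with [k = 1] and [l = 2]: removing from a Hamiltonian cycle a perfect matching that it
    extends leaves another perfect matching. *)
Lemma regular_setD k l F H :
  F \subset H -> regular_in k F -> regular_in l H -> regular_in (l - k) (H :\: F).
Proof.
move=> sFH regF regH x; rewrite -(regH x) -(regF x) /degree_in.
by rewrite setIDA cardsD -setIA (setIidPr sFH).
Qed.

(** Each colour class has [#|M|] vertices, and the degrees in [F] sum to [#|F|] over either class.
    The class without [w] gives [#|F| = #|M|], which leaves exactly 1 for [w] in the other class. *)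
Lemma bipartite_degree1 F w :
    bipartite G -> (exists M, perfect_matching M) ->
    (forall x, x != w -> degree_in F x = 1) ->
  degree_in F w = 1.
Proof.
case=> A0 bipA0 [M pmM] F1.
have sumE E A : (forall e, #|ends e :&: A| = 1) ->
    \sum_(x in A) degree_in E x = #|E|.
  move=> bipA; rewrite sum_degree_in -sum1_card.
  by apply: eq_bigr => e _; rewrite bipA.
have cardE A : (forall e, #|ends e :&: A| = 1) -> #|A| = #|M|.
  by move=> bipA; rewrite -(sumE M A bipA) -sum1_card; apply: eq_bigr => x _.
have bipA0C e : #|ends e :&: ~: A0| = 1.
  by rewrite -setDE cardsD card_ends bipA0.
(* The complement of a colour class is again one, so [A] can be chosen to contain [w]. *)
have [A bipA [bipAC wA]] : exists2 A, forall e, #|ends e :&: A| = 1 &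
    (forall e, #|ends e :&: ~: A| = 1) /\ w \in A.
  case: (boolP (w \in A0)) => wA0; first by exists A0.
  by exists (~: A0); rewrite // inE setCK.
have sum1 (B : {set vert G}) :
    w \notin B -> \sum_(x in B) degree_in F x = #|B|.
  move=> wB; rewrite -sum1_card; apply: eq_bigr => x xB; apply: F1.
  by apply: contraNneq wB => <-.
have := sumE F A bipA; rewrite (big_setD1 w) //= sum1 ?setD11 //.
rewrite -(sumE F _ bipAC) sum1 ?inE ?wA // (cardE _ bipAC) -(cardE _ bipA).
by rewrite (cardsD1 w A) wA => /addIn.
Qed.

(** Let [C] be the component of [x] in [H - w]. An even number of edges of [H] join [w] to [C], and
    [e] is one of them, so both edges of [H] at [w] lead into [C]. As [H] is connected, [C] contains
    every vertex other than [w]. *)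
Lemma hamiltonian_setD_connect H w (e : edge G) x y :
    hamiltonian_cycle H -> e \in H -> ends e = [set w; x] ->
    x != w -> y != w ->
  connect (adjacent_in (H :\: incident w)) x y.
Proof.
case=> regH connH eH eE xw yw; set F := H :\: incident w.
have symF := sym_connect_sym (adjacent_in_sym F).
pose C := [set z | connect (adjacent_in F) x z].
have wC : w \notin C.
  rewrite inE symF; apply/connectP => -[[|z p] /=].
    by move=> _ /eqP; rewrite (negPf xw).
  case/andP=> /existsP[f /andP[]]; rewrite !inE => /andP[wf _] /eqP fE.
  by rewrite fE set21 in wf.
have closedC f s t : f \in F -> ends f = [set s; t] -> s \in C -> t \in C.
  move=> fF fE; rewrite !inE => /connect_trans -> //.
  by apply: connect1; apply/existsP; exists f; rewrite fF fE eqxx.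
(* Handshake in [C]: the edges of [H] between [w] and [C] are even in number. *)
have even_cut : ~~ odd (\sum_(f in H :&: incident w) #|ends f :&: C|).
  have := sum_degree_in H C.
  rewrite (eq_bigr (fun=> 2)) => [|z _]; last exact: regH.
  rewrite sum_nat_const (big_setID (incident w)) /= -/F => /(congr1 odd).
  rewrite oddM andbF oddD => /esym/negbT.
  (* An edge of [F] has either no end or both ends in [C], so these edges contribute an even
     amount. *)
  suff -> : odd (\sum_(f in F) #|ends f :&: C|) = false by rewrite addbF.
  apply/negbTE; elim/big_ind: _ => // [m n|f fF].
    by rewrite oddD => /negPf-> /negPf->.
  case: (set_0Vmem (ends f :&: C)) => [->|[s]]; first by rewrite cards0.
  rewrite inE => /andP[/exists_other_end[t ts fE] sC].
  have tC := closedC _ _ _ fF fE sC.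
  rewrite (setIidPl _) ?card_ends // fE subUset !sub1set sC; exact: tC.
have eHw : e \in H :&: incident w by rewrite !inE eH eE set21.
have xC : x \in C by rewrite inE connect0.
have cardC f z : ends f = [set w; z] -> #|ends f :&: C| = (z \in C).
  move=> fE; rewrite fE setIUl; have -> : [set w] :&: C = set0.
    by apply/setP=> s; rewrite !inE; case: eqP => // ->;
       rewrite inE in wC; rewrite (negPf wC).
  rewrite set0U; case: (boolP (z \in C)) => zC.
    by rewrite (setIidPl _) ?sub1set ?cards1.
  apply/eqP; rewrite cards_eq0; apply/eqP/setP=> s.
  rewrite in_setI in_set1 in_set0.
  by case: eqP => // ->; rewrite (negPf zC).
(* If [f] differs from [e], these two are all the edges of [H] at [w]; since [x] is in [C], parity
   of the cut forces [z] into [C]. *)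
have nbrC f z : f \in H -> ends f = [set w; z] -> z \in C.
  move=> fH fE; have [fe|fe] := eqVneq f e.
    have : x \in [set w; z] by rewrite -fE fe eE set22.
    by rewrite in_set2 (negPf xw) => /eqP<-.
  have fHw : f \in H :&: incident w by rewrite !inE fH fE set21.
  have HwE : H :&: incident w = [set e; f].
    apply/esym/eqP; rewrite eqEcard cards2 eq_sym fe subUset !sub1set eHw fHw /=.
    by rewrite setIC [#|_|]regH.
  move: even_cut; rewrite HwE big_setU1 ?big_set1 ?in_set1 1?eq_sym //=.
  by rewrite (cardC _ _ eE) (cardC _ _ fE) xC; case: (z \in C).
suff yC : y \in C by rewrite inE in yC.
(* On an [H]-path from [y] to [w], the vertex before the first visit to [w] is in [C] by [nbrC];
   [closedC] carries membership back to [y]. *)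
case/connectP: (connH y w) yw => p; elim: p y => [|z p IHp] y /=.
  by move=> _ <-; rewrite eqxx.
case/andP=> /existsP[f /andP[fH /eqP fE]] pP wE yw.
have [zw|zw] := eqVneq z w; first by apply: nbrC fH _; rewrite fE zw setUC.
apply: (closedC f z); rewrite 1?fE 1?setUC //; last exact: IHp.
by rewrite !inE fE !inE !(eq_sym w) negb_or yw zw.
Qed.

End Graph.

(** Away from [w], the edge map [p] and the vertex map [q] identify [G - w] and
    the edges at [w] with a part of [K]; the images under [p] of the edges at [w]
    have one end in the image of [q]. *)
Definition vertex_deleted_embedding (G K : mgraph) (w : vert G)
    (p : edge G -> edge K) (q : {x | x != w} -> vert K) : Prop :=
  [/\ injective p, injective q &
      forall x, incident (q x) = p @: incident (val x)].

(** * Transfer of degrees and connectivity along an embedding *)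

Section Embedding.
Variables (G K : mgraph) (w : vert G).
Variables (p : edge G -> edge K) (q : {x | x != w} -> vert K).
Implicit Types (F : {set edge G}) (S : {set edge K}).

Lemma embedding_degree_in S x :
  vertex_deleted_embedding p q ->
  degree_in S (q x) = degree_in (p @^-1: S) (val x).
Proof.
case=> p_inj _ incq; rewrite /degree_in incq -(card_imset _ p_inj).
apply: eq_card => f; rewrite inE; apply/andP/imsetP.
  by case=> /imsetP[e ex ->] fS; exists e; rewrite // in_setI ex inE.
by case=> e /setIP[ex]; rewrite inE => eS ->; rewrite imset_f.
Qed.

Lemma embedding_ends e x :
  vertex_deleted_embedding p q -> (q x \in ends (p e)) = (val x \in ends e).
Proof.
case=> p_inj _ incq; have := mem_imset (incident (val x)) e p_inj.
by rewrite -incq !inE.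
Qed.

(** The edges of the path avoid [w], so its vertices lie in the domain of [q] and its edges map
    under [p] to edges of [S] joining their images. *)
Lemma embedding_connect F S x y :
    vertex_deleted_embedding p q -> F \subset p @^-1: S ->
    connect (adjacent_in (F :\: incident w)) (val x) (val y) ->
  connect (adjacent_in S) (q x) (q y).
Proof.
move=> pq sFS /connectP[s]; have [_ q_inj _] := pq.
elim: s x => [|z s IHs] x /=; first by move=> _ /val_inj->; apply: connect0.
case/andP=> /existsP[e /andP[]]; rewrite !inE => /andP[we eF] /eqP eE sP yE.
have zw : z != w by apply: contraNneq we => <-; rewrite eE set22.
apply: connect_trans (IHs (Sub z zw) _ _); rewrite ?SubK //.
have [<-|xz] := eqVneq x (Sub z zw); first exact: connect0.
apply: connect1; apply/existsP; exists (p e).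
have := subsetP sFS _ eF; rewrite inE => -> /=.
by apply/eqP/ends_eq2; rewrite ?inj_eq // embedding_ends // eE /= !inE eqxx ?orbT.
Qed.

Lemma embedding_hamiltonian_connect H S (e : edge G) x y :
    vertex_deleted_embedding p q -> hamiltonian_cycle H ->
    H \subset p @^-1: S -> e \in H -> ends e = [set w; val x] ->
  connect (adjacent_in S) (q x) (q y).
Proof.
move=> pq hamH sHS eH eE; apply: embedding_connect sHS _ => //.
exact: hamiltonian_setD_connect eE (valP x) (valP y).
Qed.

End Embedding.

(** * Edges at a vertex and edges away from it *)

Section SplitEdge.
Variables (G : mgraph) (w : vert G) (o : edge_ordering w).

(** The default [ord0] is never used: every edge at [w] is some [o i]. *)
Definition split_edge (e : edge G) : {e : edge G | e \notin incident w} + 'I_3 :=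
  match insub e with
  | Some e' => inl e'
  | None => inr (odflt ord0 [pick i | o i == e])
  end.

Lemma split_edge_nth i : split_edge (o i) = inr i.
Proof.
have wo : o i \in incident w by rewrite -(nth_edge_incident o) imset_f.
rewrite /split_edge insubN ?negbK //; congr inr.
by case: pickP => [j /eqP/nth_edge_inj|/(_ i)] //=; rewrite eqxx.
Qed.

Lemma split_edge_val (e : {e : edge G | e \notin incident w}) :
  split_edge (val e) = inl e.
Proof. by rewrite /split_edge valK. Qed.

(** A case view in which [split_edge] computes in either branch, by [split_edge_val] and
    [split_edge_nth]. *)
Variant edge_at_spec : edge G -> Type :=
  | EdgeOff (e : {e : edge G | e \notin incident w}) : edge_at_spec (val e)
  | EdgeAt i : edge_at_spec (o i).

Lemma edge_atP e : edge_at_spec e.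
Proof.
case: (boolP (e \in incident w)) => we; last exact: (EdgeOff (Sub e we)).
have [i /eqP <-|noi] := pickP (fun i => o i == e); first exact: EdgeAt.
move: we; rewrite -(nth_edge_incident o) => we; exfalso.
by case/imsetP: we => i _ eE; have := noi i; rewrite eE eqxx.
Qed.

End SplitEdge.

(** * Embedding the factors in the star product and gluing edge sets *)

Section StarProduct.
Variables (G1 G2 : mgraph) (u : vert G1) (v : vert G2).
Variables (a : edge_ordering u) (b : edge_ordering v).
Let K := star_product a b.

(** Sending [a i] to the [i]-th new edge makes the images of the two factors overlap exactly in the
    three new edges. *)
Definition star_left (e : edge G1) : edge K :=
  match split_edge a e with inl e1 => inl (inl e1) | inr i => inr i end.

Definition star_right (e : edge G2) : edge K :=
  match split_edge b e with inl e2 => inl (inr e2) | inr i => inr i end.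

Definition star_inl (x : {x | x != u}) : vert K := inl x.
Definition star_inr (y : {y | y != v}) : vert K := inr y.

Lemma star_left_embedding : vertex_deleted_embedding star_left star_inl.
Proof.
split=> [e f|x y []//|x].
  rewrite /star_left; case: (edge_atP a e) => [e'|i];
    case: (edge_atP a f) => [f'|j];
  by rewrite ?split_edge_val ?split_edge_nth // => -[->].
have inl_inj : injective (@inl {x | x != u} {y | y != v}) by move=> ? ? [].
apply/setP=> f; rewrite inE; apply/idP/imsetP => [|[e]].
  case: f => [[e|e]|i] /=.
  - rewrite mem_imset // inE => xe; exists (val e); first by rewrite inE.
    by rewrite /star_left split_edge_val.
  - by case/imsetP.
  rewrite inE mem_imset // inE => /orP[xi|/imsetP[]//].
  by exists (a i); rewrite ?inE // /star_left split_edge_nth.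
rewrite inE /star_left => xe ->; case: (edge_atP a e) xe => [e'|i] xe.
  by rewrite split_edge_val /= mem_imset // inE.
by rewrite split_edge_nth /= inE mem_imset // inE xe.
Qed.

Lemma star_right_embedding : vertex_deleted_embedding star_right star_inr.
Proof.
split=> [e f|x y []//|x].
  rewrite /star_right; case: (edge_atP b e) => [e'|i];
    case: (edge_atP b f) => [f'|j];
  by rewrite ?split_edge_val ?split_edge_nth // => -[->].
have inr_inj : injective (@inr {x | x != u} {y | y != v}) by move=> ? ? [].
apply/setP=> f; rewrite inE; apply/idP/imsetP => [|[e]].
  case: f => [[e|e]|i] /=.
  - by case/imsetP.
  - rewrite mem_imset // inE => xe; exists (val e); first by rewrite inE.
    by rewrite /star_right split_edge_val.
  rewrite inE mem_imset // inE => /orP[/imsetP[]//|xi].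
  by exists (b i); rewrite ?inE // /star_right split_edge_nth.
rewrite inE /star_right => xe ->; case: (edge_atP b e) xe => [e'|i] xe.
  by rewrite split_edge_val /= mem_imset // inE.
by rewrite split_edge_nth /= inE mem_imset // inE xe orbT.
Qed.

Definition glue (F1 : {set edge G1}) (F2 : {set edge G2}) : {set edge K} :=
  star_left @: F1 :|: star_right @: F2.

(** The condition under which [F1] and [F2] are recovered from [glue F1 F2] as preimages. *)
Definition agree (F1 : {set edge G1}) (F2 : {set edge G2}) : Prop :=
  forall i, (a i \in F1) = (b i \in F2).

Lemma star_left_nth i : star_left (a i) = inr i.
Proof. by rewrite /star_left split_edge_nth. Qed.

Lemma star_right_nth i : star_right (b i) = inr i.
Proof. by rewrite /star_right split_edge_nth. Qed.

Lemma star_left_right e f :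
  star_left e = star_right f -> exists i, e = a i /\ f = b i.
Proof.
rewrite /star_left /star_right.
case: (edge_atP a e) => [e'|i]; case: (edge_atP b f) => [f'|j];
by rewrite ?split_edge_val ?split_edge_nth // => -[->]; exists j.
Qed.

Lemma glue_left F1 F2 : agree F1 F2 -> star_left @^-1: glue F1 F2 = F1.
Proof.
move=> F12; have [p_inj _ _] := star_left_embedding.
apply/setP=> e; rewrite !inE mem_imset //; case: (boolP (e \in F1)) => //= eF.
apply: contraNF eF => /imsetP[f fF2 /star_left_right[i [-> fE]]].
by rewrite F12 -fE.
Qed.

Lemma glue_right F1 F2 : agree F1 F2 -> star_right @^-1: glue F1 F2 = F2.
Proof.
move=> F12; have [p_inj _ _] := star_right_embedding.
apply/setP=> f; rewrite !inE mem_imset // orbC; case: (boolP (f \in F2)) => //= fF.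
apply: contraNF fF => /imsetP[e eF1 /esym/star_left_right[i [eE ->]]].
by rewrite -F12 -eE.
Qed.

(** Every vertex of the star product comes from one factor together with all its edges, so its
    degree can be computed there. *)
Lemma glue_regular k F1 F2 :
  agree F1 F2 -> regular_in k F1 -> regular_in k F2 -> regular_in k (glue F1 F2).
Proof.
move=> F12 reg1 reg2 [x|y].
  by rewrite (embedding_degree_in _ x star_left_embedding) glue_left.
by rewrite (embedding_degree_in _ y star_right_embedding) glue_right.
Qed.

Lemma extends_glue (H1 : {set edge G1}) (H2 : {set edge G2})
    (S : {set edge K}) :
    star_left @^-1: S \subset H1 -> star_right @^-1: S \subset H2 ->
  extends (glue H1 H2) S.
Proof.
move=> /subsetP s1 /subsetP s2; apply/subsetP => -[[e|e]|i] eS; rewrite inE.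
- have lE : star_left (val e) = inl (inl e) by rewrite /star_left split_edge_val.
  by rewrite -lE imset_f // s1 // inE lE.
- have rE : star_right (val e) = inl (inr e) by rewrite /star_right split_edge_val.
  by rewrite -rE imset_f ?orbT // s2 // inE rE.
by rewrite -star_left_nth imset_f // s1 // inE star_left_nth.
Qed.

(** From the end [x] of [a i] the rest of [H1 - u] is reachable; the new edge [i] leads to the end
    [y] of [b i], and from there all of [H2 - v] is reachable. *)
Lemma glue_hamiltonian H1 H2 i :
    agree H1 H2 -> a i \in H1 -> hamiltonian_cycle H1 -> hamiltonian_cycle H2 ->
  hamiltonian_cycle (glue H1 H2).
Proof.
move=> H12 ai ham1 ham2; split.
  by apply: glue_regular => //; [case: ham1 | case: ham2].
set S := glue H1 H2; have bi : b i \in H2 by rewrite -H12.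
have ua : u \in ends (a i).
  have : a i \in incident u by rewrite -(nth_edge_incident a) imset_f.
  by rewrite inE.
have vb : v \in ends (b i).
  have : b i \in incident v by rewrite -(nth_edge_incident b) imset_f.
  by rewrite inE.
have [x xu aE] := exists_other_end ua; have [y yv bE] := exists_other_end vb.
have symS := sym_connect_sym (adjacent_in_sym S).
have conn1 z : connect (adjacent_in S) (star_inl (Sub x xu)) (star_inl z).
  apply: (embedding_hamiltonian_connect _ star_left_embedding ham1 _ ai).
    by rewrite glue_left.
  by rewrite SubK.
have conn2 z : connect (adjacent_in S) (star_inr (Sub y yv)) (star_inr z).
  apply: (embedding_hamiltonian_connect _ star_right_embedding ham2 _ bi).
    by rewrite glue_right.
  by rewrite SubK.
have conn12 :
    connect (adjacent_in S) (star_inl (Sub x xu)) (star_inr (Sub y yv)).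
  apply: connect1; apply/existsP; exists (inr i).
  apply/andP; split; first by rewrite inE -{1}star_left_nth imset_f.
  apply/eqP/ends_eq2 => //.
    by rewrite -star_left_nth (embedding_ends _ _ star_left_embedding) aE set22.
  by rewrite -star_right_nth (embedding_ends _ _ star_right_embedding) bE set22.
have conn z : connect (adjacent_in S) (star_inl (Sub x xu)) z.
  by case: z => z; [apply: conn1 | apply: connect_trans conn12 (conn2 z)].
by move=> s t; apply: connect_trans (conn t); rewrite symS; apply: conn.
Qed.

End StarProduct.

(** * Prescribing an edge at a malleable vertex *)

Section Malleable.
Variables (G : mgraph) (v : vert G) (b : edge_ordering v).

(** The two cycles given by malleability cover the edges at [v] outside [M], and an edge of [M] lies
    in both. *)
Lemma malleable_hamiltonian M i :
  malleable 3 v -> perfect_matching M ->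
  exists H, [/\ hamiltonian_cycle H, M \subset H & b i \in H].
Proof.
case=> _ _ _ mallM pmM; have [H [hamH sH]] := mallM M pmM.
case: (boolP (b i \in M)) => bM.
  have [hamH0 sMH] := hamH ord0; exists (H ord0); split=> //.
  exact: (subsetP sMH).
have /(subsetP sH)/bigcupP[j _ bH] : b i \in incident v :\: M.
  by rewrite inE bM -(nth_edge_incident b) imset_f.
by exists (H j); have [] := hamH j.
Qed.

(** If [M] misses [b i], take a Hamiltonian cycle [H] through [M] and [b i]: the complementary
    matching [H :\: M] contains [b i]. *)
Lemma malleable_perfect_matching i :
  malleable 3 v -> exists2 M, perfect_matching M & b i \in M.
Proof.
move=> mall_v; have [_ _ [M pmM] _] := mall_v.
case: (boolP (b i \in M)) => bM; first by exists M.
have [H [[regH _] sMH bH]] := malleable_hamiltonian i mall_v pmM.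
by exists (H :\: M); [apply: regular_setD sMH pmM regH | rewrite inE bM].
Qed.

End Malleable.

(** At [u] and at [v] each set contains the edges indexed by [A] and has no room for more, so both
    index sets equal [A]. *)
Lemma agreeP (G1 G2 : mgraph) (u : vert G1) (v : vert G2)
    (a : edge_ordering u) (b : edge_ordering v) F1 F2 (A : {set 'I_3}) :
    degree_in F1 u = #|A| -> degree_in F2 v = #|A| ->
    {in A, forall i, a i \in F1} -> {in A, forall i, b i \in F2} ->
  agree a b F1 F2.
Proof.
rewrite (degree_in_ordering a) (degree_in_ordering b) => d1 d2 A1 A2.
have E1 : A = [set i | a i \in F1].
  by apply/eqP; rewrite eqEcard d1 leqnn andbT; apply/subsetP=> i /A1; rewrite inE.
have E2 : A = [set i | b i \in F2].
  by apply/eqP; rewrite eqEcard d2 leqnn andbT; apply/subsetP=> i /A2; rewrite inE.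
by move=> i; have := erefl (i \in A); rewrite {1}E1 E2 !inE.
Qed.

(** * Matchings and Hamiltonian cycles of the star product *)

Theorem proposition3p4 (G1 G2 : mgraph) (u : vert G1) (v : vert G2)
    (a : edge_ordering u) (b : edge_ordering v)
    (connG1 : connected_graph G1) (connG2 : connected_graph G2)
    (nthetaG1 : ~ cubic_on_two_vertices G1)
    (nthetaG2 : ~ cubic_on_two_vertices G2)
    (pmhG1 : PMH G1) (deg_u : degree u = 3)
    (mall_v : malleable 3 v)
    (bip : bipartite G1 \/ bipartite G2) :
  PMH (star_product a b).
Proof.
have [exM1 hamM1] := pmhG1; have [_ _ exM2 _] := mall_v.
have cut1 F : degree_in F u = 1 -> exists k, a k \in F.
  by rewrite (degree_in_ordering a) => /eqP/cards1P[k /setP/(_ k)];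
     rewrite !inE eqxx => kF; exists k.
split.
  (* The edge [a k] of [M1] at [u] dictates that [M2] be chosen through [b k]. *)
  have [M1 pmM1] := exM1; have [k kM1] := cut1 _ (pmM1 u).
  have [M2 pmM2 kM2] := malleable_perfect_matching b k mall_v.
  exists (glue a b M1 M2); apply: glue_regular => //.
  by apply: (agreeP (A := [set k])); rewrite ?cards1 // => i /set1P->.
move=> M pmM.
set M1 := star_left a b @^-1: M; set M2 := star_right a b @^-1: M.
have agM : agree a b M1 M2.
  by move=> i; rewrite !inE star_left_nth star_right_nth.
have off1 x : x != u -> degree_in M1 x = 1.
  move=> xu; rewrite -(pmM (star_inl a b (Sub x xu))).
  by rewrite (embedding_degree_in _ _ (star_left_embedding a b)).
have off2 y : y != v -> degree_in M2 y = 1.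
  move=> yv; rewrite -(pmM (star_inr a b (Sub y yv))).
  by rewrite (embedding_degree_in _ _ (star_right_embedding a b)).
have degE : degree_in M1 u = degree_in M2 v.
  rewrite (degree_in_ordering a) (degree_in_ordering b).
  by apply: eq_card => i; rewrite [LHS]inE [RHS]inE agM.
(* By [degE], the count may be done in whichever factor is bipartite. *)
have u1 : degree_in M1 u = 1.
  by case: bip => bip; [|rewrite degE]; apply: bipartite_degree1.
have pmM1 : perfect_matching M1.
  by move=> x; have [->|/off1] := eqVneq x u.
have pmM2 : perfect_matching M2.
  by move=> y; have [->|/off2//] := eqVneq y v; rewrite -degE.
have [k kM1] := cut1 _ u1.
have [H1 [hamH1 sM1]] := hamM1 M1 pmM1; have [regH1 _] := hamH1.
(* [H1 :\: M1] is a perfect matching too; its edge at [u] is [a j]. *)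
have [j jH1 jM1] : exists2 j, a j \in H1 & a j \notin M1.
  have := regular_setD sM1 pmM1 regH1 u => /cut1[j].
  by rewrite inE => /andP[]; exists j.
have [H2 [hamH2 sM2 jH2]] := malleable_hamiltonian b j mall_v pmM2.
have [regH2 _] := hamH2.
have kj : k != j by apply: contraNneq jM1 => <-.
have kH1 : a k \in H1 by apply: (subsetP sM1).
(* Both cycles use the indices [k], from the matchings, and [j], by the choice of [H2]; degree 2
   excludes a third. *)
have agH : agree a b H1 H2.
  apply: (agreeP (A := [set k; j])); rewrite ?cards2 ?kj //.
    by move=> i /set2P[]->.
  by move=> i /set2P[]-> //; apply: (subsetP sM2); rewrite -agM.
exists (glue a b H1 H2); split; last exact: extends_glue.
exact: glue_hamiltonian agH kH1 hamH1 hamH2.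
Qed.
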